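(* Let $q \geq 8$ be a power of $2$, and let $G$ be a finite group with a minimal normal subgroup $N = \mathrm{PSL}_2(q)\times\cdots\times\mathrm{PSL}_2(q)$, a direct product of $k$ copies of $\mathrm{PSL}_2(q)$. Write $|G| = b(G)(b(G)+e)$. Then $e > \sqrt{b(G)}+1$, and in particular $|G| < e^4-e^3$.
   Context: $b(G)$ denotes the largest degree of a complex irreducible character of $G$. *)

(* Defs.v *)
From HB Require Import structures.
From mathcomp Require Import all_boot all_order all_algebra all_fingroup all_solvable all_field all_character.
Set Implicit Arguments. Unset Strict Implicit. Unset Printing Implicit Defensive.
Import Order.TTheory GRing.Theory Num.Theory.

(* b(G): the largest degree of a complex irreducible character of G.
   Character degrees are natural numbers, so we take truncn of chi(1). *)
Definition bG (gT : finGroupType) (G : {group gT}) : nat :=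
  \max_(i : Iirr G) Num.truncn ('chi[G]_i 1%g).

Definition SL2 (F : finFieldType) : {set {'GL_2[F]}} :=
  [set x : {'GL_2[F]} | (\det (GLval x) == 1)%R].

Definition PSL2 (F : finFieldType) := (SL2 F / 'Z(SL2 F))%g.

(* Main.v *)
(* Every degree accounts for at most 3/5 of the sum of the squares of the
   irreducible degrees of S = PSL_2(q) = SL_2(q).  Let U be the unipotent subgroup,
   g in U nontrivial and B the Borel subgroup.  All nontrivial elements of U are
   conjugate, so chi(1) = l + a (q - 1) and chi(g) = l - a for some l, a >= 0; as
   |C_S(g)| = q, column orthogonality gives sum a^2 = q, sum a l = q - 1 and
   sum l^2 = 2 (q - 1).  If l > 0, then chi is a constituent of a character of degree
   q + 1 induced from a linear character of B; so chi(1) <= q + 1, and chi(1) = q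
   for a single chi because S is perfect.  The 3/5 bound follows for each degree.

   It passes to N = S x M because fixing the degree of a product character and its
   component on M fixes the degree of its component on S.  Constituents of chi_N,
   for chi in Irr(G), all have the same degree by Clifford, and [chi_N, chi_N] <=
   |G : N|, so chi(1)^2 <= 3/5 |G|.  Hence 3 e >= 2 b(G), where b(G) >= q - 1 >= 7,
   which is more than enough. *)

Require Import Defs.
From HB Require Import structures.
From mathcomp Require Import all_boot all_order all_algebra all_fingroup all_solvable all_field all_character.
From mathcomp Require Import ring zify.
Import Order.TTheory GRing.Theory Num.Theory.
Set Implicit Arguments. Unset Strict Implicit. Unset Printing Implicit Defensive.

(** * Coordinates in SL_2(F) *)

Section SpecialLinear.

Variable F : finFieldType.
Local Open Scope ring_scope.

Lemma det_mx2E (A : 'M[F]_2) :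
  \det A = A ord0 ord0 * A ord_max ord_max - A ord0 ord_max * A ord_max ord0.
Proof.
rewrite (expand_det_row _ ord0) !big_ord_recl big_ord0 addr0 /cofactor !det_mx11 !mxE /=.
rewrite expr0 mul1r /bump /= expr1 mulN1r mulrN.
have -> : lift ord0 (ord0 : 'I_1) = ord_max :> 'I_2 by apply/val_inj.
by have -> : lift ord_max (ord0 : 'I_1) = ord0 :> 'I_2 by apply/val_inj.
Qed.

Lemma mulmx2E (A B : 'M[F]_2) i j :
  (A *m B) i j = A i ord0 * B ord0 j + A i ord_max * B ord_max j.
Proof.
rewrite mxE !big_ord_recl big_ord0 addr0.
by have -> : lift ord0 (ord0 : 'I_1) = ord_max :> 'I_2 by apply/val_inj.
Qed.

Definition mx2 (a b c d : F) : 'M[F]_2 :=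
  \matrix_(i, j) if i == ord0 then if j == ord0 then a else b
                 else if j == ord0 then c else d.

Lemma mx2_eta (A : 'M[F]_2) :
  A = mx2 (A ord0 ord0) (A ord0 ord_max) (A ord_max ord0) (A ord_max ord_max).
Proof.
apply/matrixP=> i j; rewrite mxE.
have ord2 (h : 'I_2) : h = if h == ord0 then ord0 else ord_max.
  by case: h => [[|[|]]] //= ?; apply/val_inj.
by rewrite {1}(ord2 i) {1}(ord2 j); do 2!case: ifP.
Qed.

Lemma mulmx2 a b c d a' b' c' d' : mx2 a b c d *m mx2 a' b' c' d' =
  mx2 (a * a' + b * c') (a * b' + b * d') (c * a' + d * c') (c * b' + d * d').
Proof. by rewrite [LHS]mx2_eta !mulmx2E !mxE. Qed.

Lemma det_mx2 a b c d : \det (mx2 a b c d) = a * d - b * c.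
Proof. by rewrite det_mx2E !mxE. Qed.

Lemma mx2_inj a b c d a' b' c' d' : mx2 a b c d = mx2 a' b' c' d' ->
  [/\ a = a', b = b', c = c' & d = d'].
Proof.
move/matrixP=> e.
by move: (e ord0 ord0) (e ord0 ord_max) (e ord_max ord0) (e ord_max ord_max);
  rewrite !mxE.
Qed.

(** The value defaults to the identity when the matrix is singular, hence the determinant hypotheses
    in the lemmas on [sl2]. *)
Definition sl2 (a b c d : F) : {'GL_2[F]} := insubd (1%g : {'GL_2[F]}) (mx2 a b c d).

Lemma val_sl2 a b c d : a * d - b * c = 1 -> GLval (sl2 a b c d) = mx2 a b c d.
Proof. by move=> e; apply: insubdK; rewrite -topredE /= unitmxE det_mx2 e unitr1. Qed.

Lemma mem_sl2 a b c d : a * d - b * c = 1 -> sl2 a b c d \in SL2 F.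
Proof. by move=> e; rewrite inE val_sl2 // det_mx2 e. Qed.

Variant SL2_spec : {'GL_2[F]} -> Prop :=
  SL2Spec a b c d of a * d - b * c = 1 : SL2_spec (sl2 a b c d).

Lemma SL2P x : x \in SL2 F -> SL2_spec x.
Proof.
rewrite inE [GLval x]mx2_eta det_mx2 => /eqP e.
have -> : x = sl2 (GLval x ord0 ord0) (GLval x ord0 ord_max)
    (GLval x ord_max ord0) (GLval x ord_max ord_max); last by [].
by apply/val_inj; rewrite [RHS]val_sl2 -?mx2_eta.
Qed.

Lemma sl2_inj a b c d a' b' c' d' :
  a * d - b * c = 1 -> a' * d' - b' * c' = 1 ->
  sl2 a b c d = sl2 a' b' c' d' -> [/\ a = a', b = b', c = c' & d = d'].
Proof. by move=> e e' /(congr1 (@GLval 2 F)); rewrite !val_sl2 // => /mx2_inj. Qed.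

Lemma sl2M a b c d a' b' c' d' :
  a * d - b * c = 1 -> a' * d' - b' * c' = 1 ->
  (sl2 a b c d * sl2 a' b' c' d')%g =
  sl2 (a * a' + b * c') (a * b' + b * d') (c * a' + d * c') (c * b' + d * d').
Proof.
move=> e e'; apply/val_inj; rewrite [RHS]val_sl2; last first.
  by transitivity ((a * d - b * c) * (a' * d' - b' * c')); [ring | rewrite e e' mulr1].
by rewrite [LHS]GL_MxE !val_sl2 // mulmx2.
Qed.

Lemma sl2_1 : sl2 1 0 0 1 = 1%g.
Proof.
apply/val_inj; rewrite [LHS]val_sl2 ?mulr1 ?mulr0 ?subr0 //.
by rewrite [RHS]GL_1E (mx2_eta 1) !mxE.
Qed.

Lemma sl2V a b c d : a * d - b * c = 1 -> (sl2 a b c d)^-1%g = sl2 d (- b) (- c) a.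
Proof.
move=> e; apply/eqP; rewrite eq_invg_mul sl2M //; last by rewrite -e; ring.
by apply/eqP; rewrite -sl2_1; congr (sl2 _ _ _ _); rewrite -?e; ring.
Qed.

Lemma SL2_group_set : group_set (SL2 F).
Proof.
apply/group_setP; split=> [|x y]; first by rewrite inE det1.
by rewrite !inE det_mulmx => /eqP -> /eqP ->; rewrite mulr1.
Qed.

Canonical SL2_group := Group SL2_group_set.

(** * Borel and unipotent subgroups, and the order of SL_2(F) *)

Definition borel : {set {'GL_2[F]}} :=
  [set x in SL2 F | GLval x ord_max ord0 == 0].

Definition unipotent : {set {'GL_2[F]}} := [set sl2 1 b 0 1 | b : F].

Lemma det_upper (a b : F) : a != 0 -> a * a^-1 - b * 0 = 1.
Proof. by move=> nza; rewrite mulr0 subr0 divff. Qed.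

Lemma det_unip b : 1 * 1 - b * 0 = 1 :> F.
Proof. by rewrite mulr0 subr0 mulr1. Qed.

Lemma borelP x : reflect (exists2 ab, ab.1 != 0 & x = sl2 ab.1 ab.2 0 ab.1^-1)
                         (x \in borel).
Proof.
rewrite inE; apply: (iffP andP) => [[/SL2P[a b c d e]]|[[a b] /= nza ->]].
  rewrite val_sl2 // mxE /= => /eqP c0; exists (a, b) => /=.
    by apply: contra_eq_neq e => ->; rewrite c0 mul0r mulr0 subr0 eq_sym oner_eq0.
  rewrite c0 mulr0 subr0 in e *; congr (sl2 _ _ _ _).
  have nza : a != 0 by apply: contra_eq_neq e => ->; rewrite mul0r eq_sym oner_eq0.
  by apply: (mulfI nza); rewrite e divff.
by rewrite mem_sl2 ?val_sl2 ?det_upper // mxE.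
Qed.

Lemma borel_group_set : group_set borel.
Proof.
apply/group_setP; split=> [|x y].
  by rewrite inE group1 -sl2_1 val_sl2 ?det_unip // mxE eqxx.
move=> /borelP[[a b] /= nza ->] /borelP[[a' b'] /= nza' ->].
rewrite sl2M ?det_upper //; apply/borelP.
exists (a * a', a * b' + b * a'^-1); rewrite ?mulf_neq0 //=.
by congr (sl2 _ _ _ _); field; rewrite ?nza ?nza'.
Qed.

Canonical borel_group := Group borel_group_set.

Lemma unip_group_set : group_set unipotent.
Proof.
apply/group_setP; split=> [|x y].
  by apply/imsetP; exists 0; rewrite ?sl2_1.
move=> /imsetP[b _ ->] /imsetP[b' _ ->]; rewrite sl2M ?det_unip //.
by apply/imsetP; exists (b + b') => //; congr (sl2 _ _ _ _); ring.
Qed.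

Canonical unip_group := Group unip_group_set.

Lemma borel_sub_SL2 : borel \subset SL2 F.
Proof. by apply/subsetP=> x; rewrite inE => /andP[]. Qed.

Lemma der_borel_sub_unip : (borel^`(1) \subset unipotent)%g.
Proof.
rewrite derg1 gen_subG; apply/subsetP=> _ /imset2P[x y Bx By ->].
case/borelP: Bx By => -[a b] /= nza -> /borelP[[a' b'] /= nza' ->].
rewrite /commg /conjg !sl2V ?det_upper // !sl2M ?det_upper //;
  try by field; rewrite ?nza ?nza'.
apply/imsetP; eexists; first by [].
by congr (sl2 _ _ _ _); first [reflexivity | ring | field; rewrite nza nza'].
Qed.

Lemma unip_normal_borel : (unipotent <| borel)%g.
Proof.
apply/andP; split.
  apply/subsetP=> _ /imsetP[b _ ->]; apply/borelP.
  by exists (1, b); rewrite ?oner_eq0 ?invr1.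
apply/subsetP=> _ /borelP[[a b] /= nza ->]; rewrite inE.
apply/subsetP=> _ /imsetP[_ /imsetP[b' _ ->] ->]; rewrite conjgE sl2V ?det_upper //.
rewrite !sl2M ?det_upper ?det_unip //; last 2 first.
- by field.
- by field.
apply/imsetP; exists (a^-1 * b' * a^-1)%R => //.
by congr (sl2 _ _ _ _); field.
Qed.

Lemma abelian_unip : abelian unipotent.
Proof.
apply/centsP=> _ /imsetP[b _ ->] _ /imsetP[b' _ ->].
by rewrite /commute !sl2M ?det_unip //; congr (sl2 _ _ _ _); ring.
Qed.

Lemma card_unip : #|unipotent| = #|F|.
Proof.
rewrite card_imset // => b b' /sl2_inj; rewrite !det_unip.
by case=> // _ ->.
Qed.

Lemma card_borel : #|borel| = (#|F| * #|F|.-1)%N.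
Proof.
have -> : borel = [set sl2 ab.1 ab.2 0 ab.1^-1 | ab in setX [set~ 0] [set: F]].
  apply/setP=> x; apply/borelP/imsetP => [[ab nz ->]|[ab nz ->]]; exists ab => //.
    by rewrite !inE nz.
  by move: nz; rewrite !inE andbT.
rewrite card_in_imset; first by rewrite cardsX cardsC1 cardsT mulnC.
move=> [a b] [a' b']; rewrite !inE !andbT /= => nza nza' /sl2_inj.
by rewrite !det_upper //; case=> // -> ->.
Qed.

(** Outside [borel] the entry c is nonzero, so a, c, d are free and the determinant forces b = (a d
    - 1) / c; this adds q^2 (q - 1) elements to those of [borel]. *)
Lemma card_SL2 : #|SL2 F| = (#|F| * #|F|.-1 * #|F|.+1)%N.
Proof.
rewrite -(cardsID borel) (setIidPr borel_sub_SL2) card_borel.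
have -> : SL2 F :\: borel = [set sl2 p.1.1 ((p.1.1 * p.2 - 1) / p.1.2) p.1.2 p.2 |
    p in setX (setX [set: F] [set~ 0]) [set: F]].
  apply/setP=> x; apply/setDP/imsetP => [[/SL2P[a b c d e]]|[[[a c] d]]].
    rewrite inE mem_sl2 ?val_sl2 // mxE /= => nzc.
    exists (a, c, d); rewrite ?inE ?nzc //=; congr (sl2 _ _ _ _).
    by rewrite -e opprB addrC subrK mulfK.
  rewrite !inE /= andbT => nzc ->.
  have e : a * d - (a * d - 1) / c * c = 1 by field.
  by rewrite val_sl2 // det_mx2 e mxE /= negb_and nzc eqxx orbT.
rewrite card_in_imset => [|[[a c] d] [[a' c'] d']].
  by rewrite !cardsX cardsC1 cardsT; move: #|F| => n; lia.
rewrite !inE !andbT /= => nzc nzc' /sl2_inj.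
by case=> [|| -> _ -> ->] //; field.
Qed.

(** * Characteristic 2: fusion and centralizer of unipotent elements, trivial center *)

Hypothesis F2 : (2%:R : F) = 0.

Let sqr_inj : injective (fun a : F => a ^+ 2).
Proof.
move=> a b /= e; apply/eqP; rewrite -subr_eq0 -sqrf_eq0; apply/eqP.
have -> : (a - b) ^+ 2 = (a ^+ 2 - b ^+ 2) + 2%:R * (b ^+ 2 - a * b) by ring.
by rewrite e F2; ring.
Qed.

(** Commuting with the unipotent element forces c = 0 and d = a; then a^2 = 1, and squaring is
    injective in characteristic 2, so a = 1. *)
Lemma cent_unip : ('C_(SL2 F)[sl2 (1 : F)%R 1%R 0%R 1%R] = unipotent)%g.
Proof.
apply/setP=> x; apply/setIP/imsetP => [[/SL2P[a b c d e] /cent1P]|[b _ ->]].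
  rewrite /commute !sl2M ?det_unip // => /sl2_inj [];
    try by (transitivity (a * d - b * c); [ring | exact: e]).
  rewrite !(mulr1, mulr0, mul1r, mul0r, addr0, add0r) => ea eb _ _.
  have c0 : c = 0 by apply: (addrI a); rewrite addr0.
  have ed : d = a by apply: (addIr b); rewrite eb addrC.
  have a1 : a = 1 by apply: sqr_inj; rewrite /= expr1n -e c0 ed; ring.
  by exists b; rewrite // c0 ed a1.
split; first by rewrite mem_sl2 ?det_unip.
by apply/cent1P; rewrite /commute !sl2M ?det_unip //; congr (sl2 _ _ _ _); ring.
Qed.

(** Conjugation by diag(a^-1, a) multiplies the upper right entry by a^2, and every element of F is
    a square because squaring is injective on a finite set. *)
Lemma unip_conj x : x \in unipotent -> x != 1%g ->
  x \in (sl2 (1 : F)%R 1%R 0%R 1%R ^: SL2 F)%g.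
Proof.
case/imsetP=> b _ -> ntb.
have nzb : b != 0 by apply: contraNneq ntb => ->; rewrite sl2_1.
have [f fK Kf] := injF_bij sqr_inj.
set a := f b; have eb : a ^+ 2 = b := Kf b.
have nza : a != 0 by apply: contraNneq nzb => a0; rewrite -eb a0 expr0n.
have e : a^-1 * a - 0 * 0 = 1 by rewrite mulr0 subr0 mulVf.
apply/imsetP; exists (sl2 a^-1 0 0 a); first exact: mem_sl2.
rewrite conjgE sl2V // !sl2M ?det_unip //; last 2 first.
- by field.
- by field.
by rewrite -eb; congr (sl2 _ _ _ _); field.
Qed.

(** A central element is unipotent by [cent_unip]; commuting with the matrix of rows (0, 1) and (-1,
    0) then kills its upper right entry. *)
Lemma center_SL2 : ('Z(SL2 F) = 1)%g.
Proof.
apply/trivgP/subsetP=> x /setIP[Sx /centP cSx].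
have /imsetP[b _ ex] : x \in unipotent.
  by rewrite -cent_unip inE Sx; apply/cent1P/cSx/mem_sl2/det_unip.
have e : 0 * 0 - 1 * -1 = 1 :> F by ring.
have := cSx _ (mem_sl2 e); rewrite /commute ex !sl2M ?det_unip //.
case/sl2_inj; try by ring.
rewrite !(mulrN1, mulr0, mul1r, mul0r, addr0, add0r) => /eqP.
by rewrite oppr_eq0 => /eqP -> _ _ _; rewrite sl2_1 set11.
Qed.

Lemma isog_PSL2 : PSL2 F \isog SL2 F.
Proof. by rewrite /PSL2 center_SL2 isog_sym quotient1_isog. Qed.

End SpecialLinear.

(** * Irreducible degrees as natural numbers *)

Definition irrdeg {gT : finGroupType} {G : {group gT}} (i : Iirr G) : nat :=
  Num.truncn ('chi_i 1%g).

Definition degmass {gT : finGroupType} (G : {group gT}) (f : nat) : nat :=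
  \sum_(i : Iirr G | irrdeg i == f) irrdeg i ^ 2.

Section Degrees.

Variables (gT : finGroupType) (G : {group gT}).
Local Open Scope ring_scope.

Lemma irrdegE (i : Iirr G) : 'chi_i 1%g = (irrdeg i)%:R.
Proof. by rewrite truncnK ?Cnat_irr1. Qed.

Lemma irrdeg_gt0 (i : Iirr G) : (0 < irrdeg i)%N.
Proof. by rewrite -(ltr_nat algC) -irrdegE irr1_gt0. Qed.

Lemma sum_irrdeg_sqr : (\sum_(i : Iirr G) irrdeg i ^ 2)%N = #|G|.
Proof.
apply/eqP; rewrite -(eqr_nat algC) -irr_sum_square natr_sum; apply/eqP.
by apply: eq_bigr => i _; rewrite irrdegE natrX.
Qed.

End Degrees.

(** * Arithmetic of degrees of the form l + a (q - 1) *)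

Lemma fixed_gt0_deg_q a l q : 8 <= q -> l + a * q.-1 = q -> 0 < l.
Proof. by case: q => [|p] //= p7; case: a => [|[|a]] e; first [lia | nia]. Qed.

Lemma fixed_gt1_deg_q1 a l q : 8 <= q -> l + a * q.-1 = q.+1 -> 1 < l.
Proof. by case: q => [|p] //= p7; case: a => [|[|a]] e; first [lia | nia]. Qed.

Lemma mixed_deg_le_q1 a l q : 8 <= q -> 0 < a -> 0 < l -> l + a * q.-1 <= q.+1 ->
  l + a * q.-1 = q \/ l + a * q.-1 = q.+1.
Proof. by case: q => [|p] //= p7; case: a => [|[|a]] // _ l0 e; first [lia | nia]. Qed.

Lemma leq_4mul_sqr a l : 4 * (a * l) <= 4 * a ^ 2 + l ^ 2.
Proof. by have [] := nat_Cauchy (2 * a) l; nia. Qed.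

Lemma mass_bound_q q : 8 <= q -> 5 * q ^ 2 <= 3 * (q * q.-1 * q.+1).
Proof. by case: q => [|p] //= p7; nia. Qed.

(** Here n counts the characters of degree q + 1: each has l >= 2, and the l^2 sum to 2 (q - 1). *)
Lemma mass_bound_q1 n q : 8 <= q -> n * 4 <= 2 * q.-1 ->
  5 * (n * q.+1 ^ 2) <= 3 * (q * q.-1 * q.+1).
Proof.
case: q => [|p] //= p7 le_n.
have h1 : 2 * n * p.+2 ^ 2 <= p * p.+2 ^ 2 by rewrite leq_mul2r; apply/orP; right; lia.
have h2 : p * p.+2 * (5 * p.+2) <= p * p.+2 * (6 * p.+1).
  by rewrite leq_mul2l; apply/orP; right; lia.
nia.
Qed.

(** The second hypothesis amounts to 2 m <= (q - 1)^2 (q + 1), which is less than half of the group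
    order. *)
Lemma mass_bound_other m q : 8 <= q ->
  4 * m + q.-1 ^ 2 * (4 * q.-1) <= q.-1 ^ 2 * (4 * q + 2 * q.-1) ->
  5 * m <= 3 * (q * q.-1 * q.+1).
Proof.
case: q => [|p] //= p7 le_m.
have : 2 * m <= p ^ 2 * (p + 2) by lia.
nia.
Qed.

(** M, C and L stand for the sums of a^2, a l and l^2. Eliminating L from the first two equations
    gives M = C + 1; the third then determines C. *)
Lemma mults_linear_system q M C L : 8 <= q ->
  L + M = q + 2 * C -> L + q.-1 * C = C + q.-1 * M ->
  L + 2 * q.-1 * C + q.-1 ^ 2 * M = q * q.-1 * q.+1 ->
  [/\ M = q, C = q.-1 & L = 2 * q.-1].
Proof.
case: q => [|p] //= p7 E1 E2 E3.
have E4 : p.+1 * M = p.+1 * C.+1 by nia.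
have E5 : M = C.+1 by apply/eqP; rewrite -(eqn_pmul2l (ltn0Sn p)) E4.
have E6 : p.+1 ^ 2 * C = p.+1 ^ 2 * p by subst M; nia.
have E7 : C = p by apply/eqP; rewrite -(@eqn_pmul2l (p.+1 ^ 2)) ?E6 // expn_gt0.
by split; lia.
Qed.

(** * Restriction to U and column orthogonality at g, for abstract S, B and U *)

Section SplitDegrees.

Variables (gT : finGroupType) (S B U : {group gT}) (g : gT) (q : nat).
Hypotheses (q_ge8 : 8 <= q) (nsUB : (U <| B)%g) (sBS : B \subset S).
Hypotheses (abU : abelian U) (oU : #|U| = q) (oS : #|S| = q * q.-1 * q.+1).
Hypotheses (ntg : g != 1%g) (Ug : g \in U).
Hypothesis conjU : forall x, x \in U -> x != 1%g -> x \in (g ^: S)%g.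
Hypothesis oCg : #|'C_S[g]%g| = q.

Local Open Scope ring_scope.

Let sUS : U \subset S. Proof. exact: subset_trans (normal_sub nsUB) sBS. Qed.
Let q_neq0 : (q%:R : algC) != 0. Proof. by rewrite pnatr_eq0; lia. Qed.

Let a_ (i : Iirr S) := ('chi_i 1%g - 'chi_i g) / q%:R.

(** Both sides agree at 1 and at g, hence on U, whose nontrivial elements are S-conjugate to g. *)
Let Res_unip i : 'Res[U] 'chi[S]_i = 'chi_i g *: 1 + a_ i *: cfReg U.
Proof.
apply/cfun_inP=> x Ux; rewrite cfResE // cfunE [X in X + _]cfunE [X in _ + X]cfunE.
rewrite cfun1E Ux mulr1 cfRegE oU.
have [-> | ntx] := eqVneq; first by rewrite mulfVK // addrC subrK.
have [y Sy ->] := imsetP (conjU Ux ntx).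
by rewrite cfunJ // mulr0n mulr0 addr0.
Qed.

Let cfdot_cfReg (j : Iirr U) : '[cfReg U, 'chi_j] = 'chi_j 1%g.
Proof.
rewrite cfReg_sum cfdot_suml (bigD1 j) //= cfdotZl cfnorm_irr mulr1.
by rewrite big1 ?addr0 // => i nij; rewrite cfdotZl cfdot_irr (negPf nij) mulr0.
Qed.

(* As g represents all of U minus 1, 'chi_i restricts to U as fixmult i copies of
   the trivial character plus movmult i copies of all the nontrivial ones. *)
Definition fixmult (i : Iirr S) : nat := Num.truncn '['Res[U] 'chi_i, 1].
Definition movmult (i : Iirr S) : nat := Num.truncn (a_ i).

Let fixmultE i : (fixmult i)%:R = 'chi_i g + a_ i.
Proof.
rewrite truncnK ?Cnat_cfdot_char ?cfRes_char ?irr_char ?rpred1 //.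
by rewrite Res_unip cfdotDl cfdotZl cfnorm1 mulr1 cfdotZl -irr0 cfdot_cfReg irr0 cfun11 mulr1.
Qed.

(** [a_ i] is a natural number because it is the multiplicity in the restriction of any nontrivial
    linear character of U; one exists since U is abelian of order q > 1. *)
Let movmultE i : (movmult i)%:R = a_ i.
Proof.
have [j nzj] : exists j : Iirr U, j != 0.
  have: (1 < #|[set: Iirr U]|)%N by rewrite cardsT card_Iirr_abelian // oU; lia.
  case/card_gt1P=> j [k [_ _ njk]].
  by have [j0|] := eqVneq j 0; [exists k; rewrite -j0 eq_sym | exists j].
have lin1 : 'chi_j 1%g = 1 by rewrite lin_char1 //; apply/char_abelianP.
have e : '['Res[U] 'chi_i, 'chi_j] = a_ i.
  rewrite Res_unip cfdotDl cfdotZl [X in _ + X]cfdotZl -irr0 cfdot_irr eq_sym (negPf nzj).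
  by rewrite mulr0 add0r cfdot_cfReg lin1 mulr1.
by rewrite truncnK // -e Cnat_cfdot_char ?cfRes_char ?irr_char.
Qed.

Lemma irrdeg_split i : irrdeg i = (fixmult i + movmult i * q.-1)%N.
Proof.
apply/eqP; rewrite -(eqr_nat algC) natrD natrM fixmultE movmultE -irrdegE.
rewrite -subn1 natrB /a_; last lia.
by apply/eqP; field.
Qed.

Let chi_g i : 'chi_i g = (fixmult i)%:R - (movmult i)%:R.
Proof. by rewrite fixmultE movmultE addrK. Qed.

Lemma sum_fixmult_movmult :
  [/\ (\sum_i movmult i ^ 2 = q)%N, (\sum_i movmult i * fixmult i = q.-1)%N
    & (\sum_i fixmult i ^ 2 = 2 * q.-1)%N].
Proof.
pose M := (\sum_i movmult i ^ 2)%N; pose C := (\sum_i movmult i * fixmult i)%N.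
pose L := (\sum_i fixmult i ^ 2)%N.
(* The column of g has norm |C_S(g)| = q: the sum of (l - a)^2 is q, rearranged to avoid
   subtraction. *)
have E1 : (L + M = q + 2 * C)%N.
  apply/eqP; rewrite -(eqr_nat algC) natrD [X in _ == X]natrD natrM -oCg.
  rewrite /L /M /C !natr_sum; apply/eqP.
  have := second_orthogonality_relation g (subsetP sUS g Ug).
  rewrite class_refl mulr1n => <-; rewrite mulr_sumr -!big_split /=.
  by apply: eq_bigr => i _; rewrite chi_g rmorphB /= !conjC_nat natrM !natrX; ring.
(* The columns of 1 and g are orthogonal: the sum of (l + (q - 1) a)(l - a) vanishes. *)
have E2 : (L + q.-1 * C = C + q.-1 * M)%N.
  apply/eqP; rewrite -(eqr_nat algC) natrD [X in _ == X]natrD !natrM /L /M /C.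
  rewrite !natr_sum -subr_eq0; apply/eqP.
  have := second_orthogonality_relation g (group1 S).
  rewrite class1G inE (negPf ntg) mulr0n => eqV0.
  rewrite -[RHS]eqV0 !mulr_sumr -!big_split -sumrB /=; apply: eq_bigr => i _.
  rewrite irrdegE conjC_nat chi_g [in RHS]irrdeg_split natrD !natrM ?natrX; ring.
(* The squares of the degrees l + (q - 1) a sum to |S|. *)
have E3 : (L + 2 * q.-1 * C + q.-1 ^ 2 * M = q * q.-1 * q.+1)%N.
  rewrite -oS -sum_irrdeg_sqr /L /M /C !big_distrr -!big_split /=.
  by apply: eq_bigr => i _; rewrite irrdeg_split; ring.
exact: mults_linear_system.
Qed.

(** The a^2 sum to q > 0, so some a is positive. This later yields the lower bound on b(G). *)
Lemma ex_irrdeg_ge : exists i : Iirr S, (q.-1 <= irrdeg i)%N.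
Proof.
have [sa _ _] := sum_fixmult_movmult.
have [i ai|no_i] := pickP (fun i => 0 < movmult i)%N.
  by exists i; rewrite irrdeg_split; apply: leq_trans (leq_addl _ _); rewrite leq_pmull.
have: (0 < q)%N by apply: leq_trans q_ge8.
by rewrite -sa big1 // => i _; have := no_i i; case: (movmult i).
Qed.

(** * Characters induced from B, and the 3/5 bound *)

Hypotheses (derB : B^`(1)%g \subset U) (oB : #|B| = (q * q.-1)%N).
Hypothesis perfS : (S^`(1) = S)%g.

Let indexB : #|S : B|%g = q.+1.
Proof.
have q1 : (0 < q * q.-1)%N by rewrite muln_gt0; lia.
by rewrite -(divgS sBS) oS oB (mulKn _ q1).
Qed.

(** Since the trivial character of U occurs in ['chi_i], the restriction to B shares a constituent
    ['chi_k] with the character induced from 1 on U. Its kernel contains U, hence B', so it is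
    linear, and Frobenius reciprocity puts ['chi_i] into an induced character of degree |S : B| = q
    + 1. *)
Lemma fixmult_Ind i : (0 < fixmult i)%N ->
  exists2 k : Iirr B, k \in irr_constt ('Res[B] 'chi_i) &
  exists2 phi, phi \is a character & 'Ind[S] 'chi_k = 'chi_i + phi /\
    (irrdeg i)%:R + phi 1%g = q.+1%:R.
Proof.
move=> l_gt0; have nz : '['Res[U] 'chi_i, 1] != 0.
  by apply: contraTneq l_gt0; rewrite /fixmult => ->; rewrite truncn0.
have [k kB kU] : exists2 k : Iirr B,
    '['Res[B] 'chi_i, 'chi_k] != 0 & '['Ind[B] (1 : 'CF(U)), 'chi_k] != 0.
  apply/exists_inP; apply: contraNT nz => /exists_inPn no_k.
  rewrite -(cfResRes _ (normal_sub nsUB) sBS) cfdot_Res_l cfdot_sum_irr big1 // => k _.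
  have [->|/no_k/negPn/eqP ->] := eqVneq ('['Res[B] 'chi_i, 'chi_k]) 0.
    by rewrite mul0r.
  by rewrite conjC0 mulr0.
exists k => //.
have linK : 'chi_k \is a linear_char.
  rewrite lin_irr_der1 (subset_trans derB) // constt0_Res_cfker //.
  by rewrite -constt_Ind_Res irr0.
have /constt_charP[|phi Nphi e] : i \in irr_constt ('Ind[S] 'chi_k).
  by rewrite constt_Ind_Res.
  by rewrite cfInd_char ?irr_char.
exists phi => //; split=> //; rewrite -irrdegE; have := congr1 (fun f : 'CF(S) => f 1%g) e.
by rewrite cfInd1 // cfunE lin_char1 // mulr1 => <-; rewrite indexB.
Qed.

Lemma irrdeg_fixmult i : (0 < fixmult i -> irrdeg i <= q.+1)%N.
Proof.
case/fixmult_Ind=> k _ [phi Nphi [_ e]].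
by rewrite -(ler_nat algC) -e lerDl char1_ge0.
Qed.

(** The complement phi has degree 1, so it is trivial as S is perfect; Frobenius reciprocity then
    makes ['chi_k] trivial as well. The formula shows that at most one character has degree q. *)
Lemma irrdeg_q_Ind1 i : (0 < fixmult i)%N -> irrdeg i = q ->
  'chi_i = 'Ind[S] (1 : 'CF(B)) - 1.
Proof.
case/fixmult_Ind=> k kB [phi Nphi [eInd e]] di.
have phi1 : phi 1%g = 1 by apply: (addrI (q%:R)); rewrite -{1}di e -addn1 natrD.
have linphi : phi \is a linear_char by rewrite qualifE /= Nphi phi1 eqxx.
have /irrP[j ej] := lin_char_irr linphi.
have j0 : j = 0 by apply/eqP; rewrite -subGcfker -{1}perfS -lin_irr_der1 -ej.
have k0 : k = 0.
  have : '['Ind[S] 'chi_k, 'chi_j] != 0.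
    rewrite eInd ej cfdotDl cfnorm_irr cfdot_irr.
    by rewrite natr1 pnatr_eq0.
  rewrite -irr_consttE constt_Ind_Res j0 irr0 cfRes_cfun1 // -irr0 constt_irr.
  by rewrite inE => /eqP.
by rewrite -irr0 -k0 eInd ej j0 irr0 addrK.
Qed.

Lemma degmass_le f : (5 * degmass S f <= 3 * #|S|)%N.
Proof.
have [sa sal sl] := sum_fixmult_movmult; rewrite oS.
have [fq | nfq] := eqVneq f q.
  apply: leq_trans (mass_bound_q q_ge8); rewrite leq_mul2l /=.
  rewrite /degmass fq (eq_bigr (fun=> q ^ 2)%N); last by move=> i /eqP ->.
  rewrite sum_nat_const -[X in (_ <= X)%N]mul1n leq_mul2r; apply/orP; right.
  apply/card_le1_eqP => i j; rewrite !unfold_in => /eqP di /eqP dj.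
  (* Degree q leaves only (l, a) = (q, 0) or (1, 1), both with l > 0. *)
  have fixq h : irrdeg h = q -> (0 < fixmult h)%N.
    by rewrite irrdeg_split; apply: fixed_gt0_deg_q.
  by apply: irr_inj; rewrite !irrdeg_q_Ind1 //; apply: fixq.
have [fq1 | nfq1] := eqVneq f q.+1.
  rewrite /degmass (eq_bigr (fun=> q.+1 ^ 2)%N); last by move=> i /eqP ->; rewrite fq1.
  rewrite sum_nat_const; apply: mass_bound_q1 => //.
  rewrite -sum_nat_const -sl [X in (_ <= X)%N](bigID (fun i => irrdeg i == f)) /=.
  apply: leq_trans (leq_addr _ _); apply: leq_sum => i /eqP.
  rewrite irrdeg_split fq1 => /(fixed_gt1_deg_q1 q_ge8) l2.
  by rewrite -[4%N]/(2 ^ 2)%N leq_sqr.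
apply: mass_bound_other => //.
(* Compare 4 chi(1)^2 with (q - 1)^2 (2a - l)^2 for chi(1) = l + a (q - 1):
   in the remaining degrees l = 0 or a = 0. *)
have le_i i : ((if irrdeg i == f then 4 * irrdeg i ^ 2 else 0) +
    q.-1 ^ 2 * (4 * (movmult i * fixmult i)) <=
    q.-1 ^ 2 * (4 * movmult i ^ 2 + fixmult i ^ 2))%N.
  case: eqVneq => [di|_]; last by rewrite add0n leq_mul2l leq_4mul_sqr orbT.
  have [a0 | a_gt0] := posnP (movmult i).
    have -> : irrdeg i = fixmult i by rewrite irrdeg_split a0 addn0.
    rewrite a0 mul0n !muln0 addn0 add0n leq_mul2r; apply/orP; right.
    by apply: leq_trans (_ : 2 ^ 2 <= _)%N => //; rewrite leq_sqr; lia.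
  have [l0 | l_gt0] := posnP (fixmult i).
    by rewrite irrdeg_split l0 !muln0 addn0 add0n expnMn addn0 mulnA mulnC leqnn.
  have := irrdeg_fixmult l_gt0; rewrite irrdeg_split => le_q1.
  case: (mixed_deg_le_q1 q_ge8 a_gt0 l_gt0 le_q1); rewrite -irrdeg_split di => e.
    by rewrite e eqxx in nfq.
  by rewrite e eqxx in nfq1.
have := leq_sum (index_enum _) (fun i (_ : xpredT i) => le_i i).
rewrite big_split /= -big_mkcond /= -!big_distrr /= big_split /= -!big_distrr /=.
by rewrite sa sal sl.
Qed.

End SplitDegrees.

(** * Degrees under isomorphisms, direct products, normal subgroups and induction *)

Section Transport.

Local Open Scope ring_scope.

Lemma irrdeg_isom (aT rT : finGroupType) (G : {group aT}) (H : {group rT})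
    (f : {morphism G >-> rT}) (isoGH : isom G H f) (i : Iirr G) :
  irrdeg (isom_Iirr isoGH i) = irrdeg i.
Proof. by rewrite /irrdeg isom_IirrE cfIsom1. Qed.

Lemma degmass_isog (aT rT : finGroupType) (G : {group aT}) (H : {group rT}) d :
  G \isog H -> degmass G d = degmass H d.
Proof.
case/isogP=> f injf eH; have isoGH : isom G H f by apply/isomP.
rewrite [RHS](reindex (isom_Iirr isoGH)) /=.
  by apply: eq_big => i; rewrite irrdeg_isom.
by exists (isom_Iirr (isom_sym isoGH)) => i _; rewrite ?isom_IirrK ?isom_IirrKV.
Qed.

Lemma isog_irrdeg (aT rT : finGroupType) (G : {group aT}) (H : {group rT}) :
  G \isog H -> forall i : Iirr G, exists j : Iirr H, irrdeg j = irrdeg i.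
Proof.
case/isogP=> f injf eH i; have isoGH : isom G H f by apply/isomP.
by exists (isom_Iirr isoGH i); rewrite irrdeg_isom.
Qed.

Variable gT : finGroupType.
Implicit Types G H K M N : {group gT}.

Lemma irrdeg_dprod K M N (KxM : (K \x M = N)%g) (i : Iirr K) (j : Iirr M) :
  irrdeg (dprod_Iirr KxM (i, j)) = (irrdeg i * irrdeg j)%N.
Proof.
by apply/eqP; rewrite -(eqr_nat algC) natrM -!irrdegE dprod_IirrE cfDprod1.
Qed.

(** For fixed j on M, the degree d determines the degree c of the component on K, so j contributes
    [degmass K c] times the square of its degree; these squares sum to |M|. *)
Lemma degmass_dprod (a b : nat) K M N : (K \x M = N)%g ->
  (forall d, a * degmass K d <= b * #|K|)%N ->
  forall d, (a * degmass N d <= b * #|N|)%N.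
Proof.
move=> KxM leK d.
have -> : degmass N d = (\sum_(j : Iirr M)
    \sum_(i : Iirr K | irrdeg i * irrdeg j == d) (irrdeg i * irrdeg j) ^ 2)%N.
  rewrite (exchange_big_dep xpredT) //= pair_big_dep /= /degmass.
  rewrite (reindex (dprod_Iirr KxM)) /=; last first.
    by exists (inv_dprod_Iirr KxM) => p _; rewrite ?dprod_IirrK ?inv_dprod_IirrK.
  by apply: eq_big => [[i j]|[i j] _]; rewrite irrdeg_dprod.
rewrite -(dprod_card KxM) -(sum_irrdeg_sqr M) mulnA !big_distrr /=.
apply: leq_sum => j _.
have j_gt0 := irrdeg_gt0 j.
(* If the degree of j does not divide d, the inner sum is empty. *)
have [/dvdnP[c ->] | ndvd] := boolP (irrdeg j %| d)%N; last first.
  by rewrite big1 ?muln0 // => i /eqP ed; case/negP: ndvd; rewrite -ed dvdn_mull.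
have -> : (\sum_(i : Iirr K | irrdeg i * irrdeg j == c * irrdeg j)
   (irrdeg i * irrdeg j) ^ 2 = degmass K c * irrdeg j ^ 2)%N.
  rewrite big_distrl; apply: eq_big => [i|i _]; last by rewrite expnMn.
  by rewrite eqn_pmul2r.
by rewrite mulnA leq_mul2r leK orbT.
Qed.

(** By Clifford the restriction is m times the sum of the orbit J of some psi, so chi(1) = m |J|
    psi(1). The norm bound m^2 |J| <= |G : N| is multiplied by |J| psi(1)^2 <= [degmass N] at
    psi(1). *)
Lemma irrdeg_sqr_le_degmass G N (i : Iirr G) : (N <| G)%g ->
  exists d, (irrdeg i ^ 2 <= #|G : N|%g * degmass N d)%N.
Proof.
move=> nsNG; have sNG := normal_sub nsNG.
have [j jN] := constt_cfRes_irr N i.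
exists (irrdeg j).
have := Clifford_Res_sum_cfclass nsNG jN.
have /natrP[m ->] : '['Res[N] 'chi_i, 'chi_j] \in Num.nat.
  by rewrite Cnat_cfdot_char ?cfRes_char ?irr_char.
pose J := [pred k : Iirr N | 'chi_k \in ('chi_j ^: G)%CF].
rewrite reindex_cfclass // -[X in _ *: X]/(\sum_(k | J k) 'chi_k) => eRes.
have degJ k : J k -> irrdeg k = irrdeg j.
  by case/cfclassP=> y Gy ek; rewrite /irrdeg ek cfConjg1.
have e1 : irrdeg i = (m * (#|J| * irrdeg j))%N.
  apply/eqP; rewrite -(eqr_nat algC) -irrdegE -(cfRes1 N) eRes cfunE sum_cfunE.
  rewrite (eq_bigr (fun=> (irrdeg j)%:R)) => [|k Jk]; last by rewrite irrdegE degJ.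
  by rewrite sumr_const -[_ *+ #|_|]mulr_natl !natrM.
have e2 : (m ^ 2 * #|J| <= #|G : N|%g)%N.
  have [+ _] := cfnorm_Res_leif 'chi_i sNG.
  rewrite cfnorm_irr mulr1 eRes cfnormZ cfdot_suml.
  rewrite (eq_bigr (fun=> 1)) => [|k Jk].
    by rewrite sumr_const normr_nat -natrX -natrM ler_nat.
  rewrite cfdot_sumr (bigD1 k) //= cfnorm_irr big1 ?addr0 // => h /andP[_ nhk].
  by rewrite cfdot_irr eq_sym (negPf nhk).
have e3 : (#|J| * irrdeg j ^ 2 <= degmass N (irrdeg j))%N.
  rewrite -sum_nat_const /degmass big_mkcond [X in (_ <= X)%N]big_mkcond /=.
  apply: leq_sum => k _; case: ifP => // Jk; rewrite (degJ k Jk) eqxx //.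
rewrite e1; apply: leq_trans (leq_mul e2 e3).
by rewrite leq_eqVlt; apply/orP; left; apply/eqP; ring.
Qed.

Lemma ex_irrdeg_over G H (j : Iirr H) : H \subset G ->
  exists i : Iirr G, (irrdeg j <= irrdeg i)%N.
Proof.
move=> sHG; have [i] := constt_cfInd_irr j sHG.
rewrite constt_Ind_Res => ij; exists i.
rewrite -(ler_nat algC) -!irrdegE -[X in _ <= X](cfRes1 H).
by rewrite char1_ge_constt ?cfRes_char ?irr_char.
Qed.

End Transport.

(** * From the 3/5 bound to the inequalities for e *)

Section Arithmetic.

Local Open Scope ring_scope.

(** Cancelling d leaves 2 d <= 3 e, so e >= 5 as d >= 7. Then d <= 3 e / 2 < (e - 1)^2, and d (d +
    e) <= 15 e^2 / 4 < e^3 (e - 1). *)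
Lemma large_defect_bounds (d : nat) (e : int) :
  (7 <= d)%N -> (5 * d ^ 2)%N%:Z <= 3 * (d%:Z * (d%:Z + e)) ->
  sqrtC (d%:R : algC) + 1 < e%:~R /\ d%:Z * (d%:Z + e) < e ^+ 4 - e ^+ 3.
Proof.
move=> d7 le_d; have le_de : 2 * d%:Z <= 3 * e by nia.
have e5 : 5 <= e by lia.
split; last by nia.
have e1_ge0 : 0 <= e%:~R - 1 :> algC by rewrite -(intrB _ e 1) ler0z; lia.
rewrite -ltrBrDr -(sqrCK e1_ge0) ltr_sqrtC ?nnegrE ?exprn_ge0 ?ler0n //.
rewrite -(intrB _ e 1) -rmorphXn /= -[d%:R]/(d%:Z%:~R) ltr_int; nia.
Qed.

End Arithmetic.

(** * Application to PSL_2(q) and to the minimal normal subgroup *)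

Lemma bG_irrdeg (gT : finGroupType) (G : {group gT}) :
  exists2 i : Iirr G, bG G = irrdeg i & forall j : Iirr G, irrdeg j <= irrdeg i.
Proof.
have [|i eb] := @bigop.eq_bigmax (Iirr G) (fun i => irrdeg i); first by rewrite card_ord.
by exists i => [|j]; rewrite -?eb //; apply: bigop.leq_bigmax.
Qed.

Lemma nat2_eq0_card_pow2 (F : finFieldType) f : #|F| = 2 ^ f -> (2%:R : F)%R = 0%R.
Proof. by move/card_finPcharP/(_ isT)/pcharf0. Qed.

(** Everything is transported from SL_2(F), which is isomorphic to PSL_2(F) in characteristic 2.
    Perfectness is assumed here and later comes from the minimality of N; the constant 7 is the
    least value of q - 1. *)
Lemma PSL2_degrees (F : finFieldType) (gT : finGroupType) (T : {group gT}) (f : nat) :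
  #|F| = 2 ^ f -> 8 <= #|F| -> T \isog PSL2 F -> (T^`(1) = T)%g ->
  (forall d, 5 * degmass T d <= 3 * #|T|) /\ exists i : Iirr T, 7 <= irrdeg i.
Proof.
move=> qf q8 isoT perfT; have F2 := nat2_eq0_card_pow2 qf.
have isoTS : T \isog SL2_group F := isog_trans isoT (isog_PSL2 F2).
have perfS : ((SL2_group F)^`(1) = SL2_group F)%g.
  have [h injh eS] := isogP isoTS.
  by rewrite -eS -morphim_der // perfT.
have ntg : sl2 (1 : F)%R 1%R 0%R 1%R != 1%g.
  rewrite -sl2_1; apply: contraTneq (oner_neq0 F) => /sl2_inj.
  by rewrite !det_unip => -[] // _ -> _ _; rewrite eqxx.
have Ug : sl2 (1 : F)%R 1%R 0%R 1%R \in unip_group F by apply/imsetP; exists 1%R.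
split=> [d|].
  rewrite (degmass_isog _ isoTS) (card_isog isoTS).
  apply: (degmass_le q8 (unip_normal_borel F) (borel_sub_SL2 F)
    (abelian_unip F) (card_unip F) (card_SL2 F) ntg Ug (unip_conj F2) _
    (der_borel_sub_unip F) (card_borel F) perfS).
  by rewrite cent_unip // card_unip.
have [|j] := ex_irrdeg_ge q8 (unip_normal_borel F) (borel_sub_SL2 F)
  (abelian_unip F) (card_unip F) (card_SL2 F) ntg Ug (unip_conj F2) _.
  by rewrite cent_unip // card_unip.
move=> jq; have isoST : SL2_group F \isog T by rewrite isog_sym.
have [i ei] := isog_irrdeg isoST j.
by exists i; rewrite ei (leq_trans _ jq) //; case: #|F| q8.
Qed.

Unset Implicit Arguments.

Theorem theorem5p3 (q : nat) (F : finFieldType) (gT : finGroupType)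
    (G N : {group gT}) (k : nat) (T : 'I_k -> {group gT}) (e : int) :
    #|F| = q -> (exists f : nat, q = 2 ^ f) -> 8 <= q ->
    minnormal N G -> N \subset G ->
    \big[dprod/1%g]_(i < k) T i = N ->
    (forall i, T i \isog PSL2 F) ->
    (#|G|%:Z = (bG G)%:Z * ((bG G)%:Z + e))%R ->
    (sqrtC ((bG G)%:R : algC) + 1 < e%:~R)%R /\ (#|G|%:Z < e ^+ 4 - e ^+ 3)%R.
Proof.
move=> <- {q} [f qf] q8 minN sNG defN isoT oG.
have [/andP[ntN nNG] _] := mingroupP minN.
have i0 : 'I_k.
  case: k T defN isoT => [|k] T defN _; last exact: ord0.
  by case/eqP: ntN; rewrite -defN big_ord0.
have [M defTM] : exists M : {group gT}, (T i0 \x M = N)%g.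
  rewrite (bigD1 i0) //= in defN; case/dprodP: (defN) => -[_ M _ eM] _ _ _.
  by exists M; rewrite -eM.
(* N' is normal in G, so by minimality it is 1 or N. It is not 1, since an abelian T would
   contradict the trivial center of SL_2(F). Comparing orders in N' = T' x M' gives T' = T. *)
have perfT : ((T i0)^`(1) = T i0)%g.
  have derN : (N^`(1) = N)%g.
    have [|ntN'] := eqVneq (N^`(1))%g 1%g.
      rewrite derg1 => /commG1P abN.
      have abT : abelian (T i0).
        by apply: abelianS abN; case/dprodP: defTM => _ <- _ _; apply: mulG_subl.
      have F2 := nat2_eq0_card_pow2 qf.
      have isoTS : T i0 \isog SL2_group F := isog_trans (isoT i0) (isog_PSL2 F2).
      have := center_SL2 F2; rewrite (isog_abelian isoTS) in abT.
      rewrite (center_idP abT) => /(congr1 (fun A : {set _} => #|A|)).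
      by rewrite cards1 card_SL2; case: #|F| q8 => [|[|p]] //.
    case/mingroupP: minN => _; apply; rewrite ?der_sub // ntN'.
    exact: gFnorm_trans.
  have defTM' := der_dprod 1 defTM; apply/eqP; rewrite eqEcard der_sub /=.
  rewrite -(leq_pmul2r (cardG_gt0 M)) (dprod_card defTM).
  have <- : #|N^`(1)%g| = #|N| by rewrite derN.
  by rewrite -(dprod_card defTM') leq_mul2l subset_leq_card ?der_sub ?orbT.
have [massT [j j7]] := PSL2_degrees qf q8 (isoT i0) perfT.
have massN := degmass_dprod defTM massT.
have sTG : T i0 \subset G.
  by apply: subset_trans sNG; case/dprodP: defTM => _ <- _ _; apply: mulG_subl.
have [i ji] := ex_irrdeg_over j sTG.
have [b eb bmax] := bG_irrdeg G.
(* Applied to a character b of largest degree, this with [massN] gives 5 b(G)^2 <= 3 |G|. *)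
have [d le_d] := irrdeg_sqr_le_degmass b (introT andP (conj sNG nNG)).
rewrite oG; apply: large_defect_bounds.
  by rewrite eb (leq_trans (leq_trans j7 ji) (bmax i)).
have le_b : 5 * irrdeg b ^ 2 <= 3 * #|G|.
  rewrite -(Lagrange sNG) mulnA [X in _ <= X]mulnC.
  apply: leq_trans (leq_mul (leqnn _) (massN d)); rewrite mulnCA leq_mul2l.
  exact: leq_trans le_d _.
by rewrite -oG eb; lia.
Qed.
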